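(* Let $m\ge 1$ and $k\ge 1$ be integers and let $S$ be a subset of size $k$ of $\mathbb{Z}_m\setminus\{0\}$. If every prime factor of $m$ is larger than $k!/2$, then $S$ is sequenceable.
   Context: A finite subset $S$ of size $k$ of a group (written additively) is sequenceable if there is an ordering $(x_1,\dots,x_k)$ of its elements such that the partial sums $(s_0,s_1,\dots,s_k)$, given by $s_0=0$ and $s_i=x_1+x_2+\dots+x_i$ for $1\le i\le k$, are pairwise distinct, with the possible exception that $s_k=s_0=0$ is allowed. *)

(* Defs.v *)
From mathcomp Require Import all_boot all_order all_algebra.
Set Implicit Arguments.
Unset Strict Implicit.
Unset Printing Implicit Defensive.
Import Order.TTheory GRing.Theory Num.Theory.
Local Open Scope ring_scope.

(* s_i = x_1 + ... + x_i for s = [:: x_1; ...; x_k] and i <= k. *)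
Definition partial_sum (V : zmodType) (s : seq V) (i : nat) : V :=
  \sum_(x <- take i s) x.

(* The only repetition allowed among s_0, ..., s_k is s_0 = s_k. *)
Definition sequencing (V : zmodType) (s : seq V) : Prop :=
  forall i j : nat, (i < j <= size s)%N ->
    partial_sum s i = partial_sum s j -> i = 0%N /\ j = size s.

Definition sequenceable (V : finZmodType) (S : {set V}) : Prop :=
  exists2 s : seq V, perm_eq s (enum S) & sequencing s.

(* Main.v *)
Require Import Defs.
From mathcomp Require Import all_boot all_order all_algebra.
From mathcomp Require Import all_fingroup all_solvable.
Import Order.TTheory GRing.Theory Num.Theory.
Local Open Scope ring_scope.
Set Implicit Arguments.
Unset Strict Implicit.

(** An ordering is a sequencing as soon as no proper nonempty block of
consecutive terms has sum 0, so only the family of zero-sum subsets of S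
matters. The proof replaces S by a set of k distinct nonzero rationals in which
every zero-sum subset of S still sums to 0 ([rational_model]); an ordering of
the rationals without proper zero-sum blocks then also works for S.

The rational model is a solution y of the homogeneous linear system whose
equations are the vanishing subset sums. A generic rational solution has all
coordinates nonzero and distinct unless one of the functionals y_i or
y_i - y_j is in the rational span of the equations. In that case Cramer's rule
writes D times this functional as an integral combination of the equations,
where D is a nonzero minor of a 0/1 matrix with at most k columns. Hence D
kills x_i, or x_i - x_j, in Z_m ([span01_annihilates]). Expanding the
determinant over permutations, the even ones contribute between 0 and r!/2 and
the odd ones between -r!/2 and 0, so |D| is at most 1 or at most k!/2
([det01_bound]). All prime factors of m are larger, so D is invertible modulo m
and x_i = 0 or x_i = x_j, which is absurd.

Rationals are ordered by putting the negative ones first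
([proper_blocks_nonzero_ordering]): the partial sums go down, then up. If the
total is negative, every proper prefix then has a negative sum, whatever the
order inside the two parts; so a negative term may be chosen to start with, the
remaining terms being ordered by induction, provided that they do not sum
to 0. A positive total is treated from the other end. Since the terms are
distinct, one of two candidates leaves a nonzero remaining sum. *)

(** * Orderings of nonzero elements of an ordered ring *)

Section Ordering.
Variables (T : eqType) (R : realDomainType) (y : T -> R).
Implicit Types (s t : seq T).

Definition negatives_first t := pairwise (fun u v => (y v < 0) ==> (y u < 0)) t.

Definition blocks_nonzero t :=
  forall a b c, t = a ++ b ++ c -> b != [::] -> \sum_(i <- b) y i != 0.

Lemma sum_seq_lt0 s :
  s != [::] -> all (fun i => y i < 0) s -> \sum_(i <- s) y i < 0.
Proof.
case: s => // x s _ /= /andP[x0 /allP s0]; rewrite big_cons.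
by apply: ltr_wnDr x0; rewrite big_seq sumr_le0 // => i /s0 /ltW.
Qed.

Lemma sum_seq_gt0 s :
  s != [::] -> all (fun i => 0 < y i) s -> 0 < \sum_(i <- s) y i.
Proof.
case: s => // x s _ /= /andP[x0 /allP s0]; rewrite big_cons.
by apply: ltr_wpDr x0; rewrite big_seq sumr_ge0 // => i /s0 /ltW.
Qed.

(** If some term after the cut is negative then all terms before the cut are:
this is why a proper prefix or suffix sum has a predictable sign. *)
Lemma negatives_first_split b c :
    all (fun i => y i != 0) (b ++ c) -> negatives_first (b ++ c) ->
  all (fun i => y i < 0) b \/ all (fun i => 0 < y i) c.
Proof.
move=> nz; rewrite /negatives_first pairwise_cat => /and3P[/allrelP bc _ _].
case: (boolP (has (fun i => y i < 0) c)) => [/hasP[v vc v0]|/hasPn hc].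
  by left; apply/allP => u ub; have /implyP := bc u v ub vc; apply.
right; apply/allP => v vc; rewrite lt_def leNgt hc // andbT.
by apply: (allP nz); rewrite mem_cat vc orbT.
Qed.

(** Either the prefix consists of negative terms, or completing it to the whole
list only adds positive terms. *)
Lemma prefix_sum_lt0 b c :
    all (fun i => y i != 0) (b ++ c) -> negatives_first (b ++ c) ->
    b != [::] -> c != [::] -> \sum_(i <- b ++ c) y i <= 0 ->
  \sum_(i <- b) y i < 0.
Proof.
move=> nz nf b0 c0; rewrite big_cat /=.
case: (negatives_first_split nz nf) => [/(sum_seq_lt0 b0)//|/(sum_seq_gt0 c0)].
by move=> c_gt0; apply: lt_le_trans; rewrite ltrDl.
Qed.

Lemma suffix_sum_gt0 b c :
    all (fun i => y i != 0) (b ++ c) -> negatives_first (b ++ c) ->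
    b != [::] -> c != [::] -> 0 <= \sum_(i <- b ++ c) y i ->
  0 < \sum_(i <- c) y i.
Proof.
move=> nz nf b0 c0; rewrite big_cat /=.
case: (negatives_first_split nz nf) => [/(sum_seq_lt0 b0)|/(sum_seq_gt0 c0)//].
by move=> b_lt0 /le_lt_trans; apply; rewrite gtrDr.
Qed.

Lemma exists_neg s :
  s != [::] -> all (fun i => y i != 0) s -> \sum_(i <- s) y i <= 0 ->
  exists2 x, x \in s & y x < 0.
Proof.
move=> s0 nz; case: (boolP (has (fun i => y i < 0) s)) => [/hasP//|/hasPn h].
rewrite leNgt sum_seq_gt0 //; apply/allP => i si.
by rewrite lt_def leNgt h // (allP nz).
Qed.

Lemma exists_pos s :
  s != [::] -> all (fun i => y i != 0) s -> 0 <= \sum_(i <- s) y i ->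
  exists2 x, x \in s & 0 < y x.
Proof.
move=> s0 nz; case: (boolP (has (fun i => 0 < y i) s)) => [/hasP//|/hasPn h].
rewrite leNgt sum_seq_lt0 //; apply/allP => i si.
by rewrite lt_neqAle leNgt h // (allP nz).
Qed.

Lemma sum_rem s x :
  x \in s -> \sum_(i <- rem x s) y i = \sum_(i <- s) y i - y x.
Proof.
by move=> xs; rewrite (perm_big _ (perm_to_rem xs)) big_cons /= [y x + _]addrC addrK.
Qed.

(** Removing x leaves the sum 0 only if y x is the total, and by distinctness
this can happen for one x only; so if the choice of x is bad, any other
candidate z is good. The predicate P stands for the sign of the removed term. *)
Lemma exists_removal (P : pred T) s :
    uniq (map y s) -> (exists2 x, x \in s & P x) ->
    (forall x, x \in s -> P x -> \sum_(i <- rem x s) y i = 0 -> rem x s != [::] ->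
       exists2 z, z \in rem x s & P z) ->
  exists x, [/\ x \in s, P x & (rem x s == [::]) || (\sum_(i <- rem x s) y i != 0)].
Proof.
move=> us [x xs Px] next.
have [|] := boolP ((rem x s == [::]) || (\sum_(i <- rem x s) y i != 0)).
  by exists x.
rewrite negb_or negbK => /andP[r0 /eqP sr0].
have [z zr Pz] := next x xs Px sr0 r0.
have zs := mem_rem zr; exists z; split=> //; apply/orP; right.
move: sr0; rewrite !sum_rem // => /eqP; rewrite subr_eq0 => /eqP ->.
rewrite subr_eq0; apply: contraL us => /eqP exz.
rewrite (perm_uniq (perm_map y (perm_to_rem xs))) /= exz.
by rewrite map_f.
Qed.

(** A block that starts with the new first term is a proper prefix, hence has a
negative sum; all other blocks lie in t. *)
Lemma blocks_nonzero_cons x t :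
    all (fun i => y i != 0) (x :: t) -> negatives_first (x :: t) ->
    \sum_(i <- x :: t) y i <= 0 -> blocks_nonzero t ->
  forall a b c, x :: t = a ++ b ++ c -> b != [::] -> (a != [::]) || (c != [::]) ->
    \sum_(i <- b) y i != 0.
Proof.
move=> nz nf le0 IH [|z a] b c /= e b0 c0; last first.
  by case: e => _ e; apply: IH e b0.
by rewrite e in nz nf le0; rewrite lt_eqF // (prefix_sum_lt0 nz nf).
Qed.

Lemma blocks_nonzero_rcons x t :
    all (fun i => y i != 0) (rcons t x) -> negatives_first (rcons t x) ->
    0 <= \sum_(i <- rcons t x) y i -> blocks_nonzero t ->
  forall a b c, rcons t x = a ++ b ++ c -> b != [::] -> (a != [::]) || (c != [::]) ->
    \sum_(i <- b) y i != 0.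
Proof.
move=> nz nf ge0 IH a b c; case/lastP: c => [|c z] e b0 a0; last first.
  move: e; rewrite -!rcons_cat => /rcons_inj[e _].
  exact: IH e b0.
rewrite cats0 orbF in e a0; rewrite e in nz nf ge0.
by rewrite gt_eqF // (suffix_sum_gt0 nz nf).
Qed.

(** Terms are peeled off at the end whose sign is that of the total: a negative
first term or a positive last one. The sign pattern is part of the conclusion
because the induction needs it to control the prefixes and suffixes. *)
Lemma blocks_nonzero_ordering s :
    uniq (map y s) -> all (fun i => y i != 0) s ->
    (s == [::]) || (\sum_(i <- s) y i != 0) ->
  exists t, [/\ perm_eq t s, negatives_first t & blocks_nonzero t].
Proof.
have [m] := ubnP (size s); elim: m s => // m IH s sm us nz.
case: eqVneq => [-> _|s0 /= tot0].
  by exists [::]; split=> // -[|? ?] [|? ?] //.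
have rem_ok x : x \in s -> [/\ (size (rem x s) < m)%N, uniq (map y (rem x s)),
    all (fun i => y i != 0) (rem x s) & {subset rem x s <= s}].
  move=> xs; have sub := @mem_rem _ x s; split=> //.
  - rewrite size_rem //; move: sm; rewrite ltnS; apply: leq_trans.
    by rewrite prednK // lt0n size_eq0.
  - by move: us; rewrite (perm_uniq (perm_map y (perm_to_rem xs))) /= => /andP[].
  - by apply/allP => i /sub; apply: (allP nz).
case: (ltgtP (\sum_(i <- s) y i) 0) tot0 => // [lt0|gt0] _.
- have [||x [xs x0 hx]] := exists_removal (P := fun i => y i < 0) us.
  + exact: exists_neg (ltW lt0).
  + move=> x xs x0 e0 r0; have [_ _ nzr _] := rem_ok x xs.
    by apply: exists_neg => //; rewrite e0.
  have [szr ur nzr _] := rem_ok x xs.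
  have [t [pt nf bt]] := IH _ szr ur nzr hx.
  have ps : perm_eq (x :: t) s.
    by rewrite perm_sym (permPl (perm_to_rem xs)) perm_cons perm_sym.
  have nf' : negatives_first (x :: t).
    by rewrite /negatives_first /= [pairwise _ _]nf andbT; apply/allP => i _; rewrite x0 implybT.
  exists (x :: t); split=> // a b c e b0.
  have [/andP[/eqP a0 /eqP c0]|ac] := boolP ((a == [::]) && (c == [::])).
    by move: e; rewrite a0 c0 cats0 /= => <-; rewrite (perm_big _ ps) lt_eqF.
  apply: (blocks_nonzero_cons _ nf' _ bt e b0); last by rewrite -negb_and.
  + by rewrite (perm_all _ ps).
  + by rewrite (perm_big _ ps) ltW.
- have [||x [xs x0 hx]] := exists_removal (P := fun i => 0 < y i) us.
  + exact: exists_pos (ltW gt0).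
  + move=> x xs x0 e0 r0; have [_ _ nzr _] := rem_ok x xs.
    by apply: exists_pos => //; rewrite e0.
  have [szr ur nzr _] := rem_ok x xs.
  have [t [pt nf bt]] := IH _ szr ur nzr hx.
  have ps : perm_eq (rcons t x) s.
    by rewrite perm_rcons perm_sym (permPl (perm_to_rem xs)) perm_cons perm_sym.
  have nf' : negatives_first (rcons t x).
    rewrite /negatives_first pairwise_rcons [pairwise _ _]nf andbT.
    by apply/allP => i _; rewrite ltNge (ltW x0).
  exists (rcons t x); split=> // a b c e b0.
  have [/andP[/eqP a0 /eqP c0]|ac] := boolP ((a == [::]) && (c == [::])).
    by move: e; rewrite a0 c0 cats0 /= => <-; rewrite (perm_big _ ps) gt_eqF.
  apply: (blocks_nonzero_rcons _ nf' _ bt e b0); last by rewrite -negb_and.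
  + by rewrite (perm_all _ ps).
  + by rewrite (perm_big _ ps) ltW.
Qed.

(** When the total is 0, any negative first term leaves a positive total, to
which the previous lemma applies. *)
Theorem proper_blocks_nonzero_ordering s :
    uniq (map y s) -> all (fun i => y i != 0) s ->
  exists2 t, perm_eq t s & forall a b c, t = a ++ b ++ c -> b != [::] ->
    \sum_(i <- b) y i = 0 -> a = [::] /\ c = [::].
Proof.
move=> us nz.
have [h|] := boolP ((s == [::]) || (\sum_(i <- s) y i != 0)).
  have [t [pt _ bt]] := blocks_nonzero_ordering us nz h.
  by exists t => // a b c e b0 /eqP; rewrite (negPf (bt _ _ _ e b0)).
rewrite negb_or negbK => /andP[s0 /eqP sum0].
have [|x xs x0] := exists_neg s0 nz; first by rewrite sum0.
have ur : uniq (map y (rem x s)).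
  by move: us; rewrite (perm_uniq (perm_map y (perm_to_rem xs))) /= => /andP[].
have nzr : all (fun i => y i != 0) (rem x s).
  by apply/allP => i /mem_rem; apply: (allP nz).
have [|t [pt nf bt]] := blocks_nonzero_ordering ur nzr.
  by rewrite sum_rem // sum0 sub0r oppr_eq0 (lt_eqF x0) orbT.
have ps : perm_eq (x :: t) s.
  by rewrite perm_sym (permPl (perm_to_rem xs)) perm_cons perm_sym.
have nf' : negatives_first (x :: t).
  by rewrite /negatives_first /= [pairwise _ _]nf andbT; apply/allP => i _; rewrite x0 implybT.
exists (x :: t) => // a b c e b0 b_sum.
have [/andP[/eqP -> /eqP ->]//|ac] := boolP ((a == [::]) && (c == [::])).
have := blocks_nonzero_cons _ nf' _ bt e b0.
rewrite b_sum eqxx -negb_and ac; case/(_ _ _ isT)/negP => //.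
  by rewrite (perm_all _ ps).
by rewrite (perm_big _ ps) sum0.
Qed.
End Ordering.

(** * Integral consequences of 0/1 equations *)

(** For r >= 2 exactly half of the permutations are even, and the determinant is
the difference of two sums of r!/2 products in [0, 1]. *)
Lemma det01_bound r (D : 'M[int]_r) :
    (forall i j, 0 <= D i j <= 1) ->
  (`|\det D| <= 1)%N || (2 * `|\det D| <= r`!)%N.
Proof.
move=> D01; case: r D D01 => [|[|r]] D D01.
- by rewrite det_mx00.
- have := D01 ord0 ord0; rewrite det_mx11.
  by case: (D ord0 ord0) => [[|[]]|] .
apply/orP; right.
have prod01 (s : 'S_r.+2) : 0 <= \prod_i D i (s i) <= 1.
  by rewrite prodr_ge0 ?prodr_ile1 // => i _; have := D01 i (s i); case/andP.
pose N := #|('Alt_('I_r.+2))%g|.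
have cardN : (2 * N = r.+2`!)%N by rewrite card_Alt card_ord.
have cardE : #|[pred s : 'S_r.+2 | ~~ s]| = N.
  by apply: eq_card => s; rewrite Alt_even inE.
have cardO : #|[pred s : 'S_r.+2 | odd_perm s]| = N.
  have := cardC [pred s : 'S_r.+2 | ~~ s].
  rewrite card_Sn -cardN cardE mul2n -addnn => /addnI <-.
  by apply: eq_card => s; rewrite !inE negbK.
have sumle (P : pred 'S_r.+2) : #|P| = N -> 0 <= \sum_(s | P s) \prod_i D i (s i) <= N%:R.
  move=> <-; apply/andP; split.
    by apply: sumr_ge0 => s _; case/andP: (prod01 s).
  by rewrite -sum1_card natr_sum ler_sum // => s _; case/andP: (prod01 s).
rewrite -cardN leq_mul2l /= -lez_nat abszE.
rewrite /determinant (bigID (@odd_perm _)) /=.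
rewrite (eq_bigr (fun s : 'S_r.+2 => - \prod_i D i (s i))); last first.
  by move=> s ->; rewrite expr1 mulN1r.
rewrite [X in _ + X](eq_bigr (fun s : 'S_r.+2 => \prod_i D i (s i))); last first.
  by move=> s /negPf ->; rewrite expr0 mul1r.
rewrite sumrN.
have /andP[o0 oN] := sumle _ cardO; have /andP[e0 eN] := sumle _ cardE.
rewrite -[Posz N]natz ler_norml; apply/andP; split.
  by rewrite -[- N%:R]addr0 lerD // lerN2.
by rewrite -[leRHS]add0r lerD // oppr_le0.
Qed.

(** Torsion appears only through the multiplier of Cramer's rule: the multiple
of c by a maximal nonzero minor of B is an integral combination of rows
of B. *)
Lemma span01_annihilates (V : zmodType) (k m : nat) (x : 'I_k -> V)
    (B : 'M[int]_(m, k)) (c : 'rV[int]_k) :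
    (forall d v, (0 < d)%N -> (2 * d <= k`!)%N -> v *+ d = 0 -> v = 0 :> V) ->
    (forall i j, 0 <= B i j <= 1) ->
    (forall i, \sum_j x j *~ B i j = 0) ->
    ((map_mx intr c : 'rV[rat]_k) <= (map_mx intr B : 'M[rat]_(m, k)))%MS ->
  \sum_j x j *~ c 0 j = 0.
Proof.
move=> torsion B01 Bx.
set A : 'M[rat]_(m, k) := map_mx _ B => cA.
(* D is a maximal minor: independent rows f of B, then independent columns g. *)
pose f := maxrankfun A; pose B' := rowsub f B.
have fullB : row_full (rowsub f A)^T.
  rewrite /row_full mxrank_tr; exact: maxrowsub_free.
pose g := fullrankfun fullB; pose D := colsub g B'.
have Dunit : (map_mx intr D : 'M[rat]_(\rank A)) \in unitmx.
  have -> : map_mx intr D = (rowsub g (rowsub f A)^T)^T.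
    by apply/matrixP => i j; rewrite !mxE.
  by rewrite unitmx_tr fullrowsub_unit.
have detD : \det D != 0.
  by move: Dunit; rewrite unitmxE det_map_mx unitfE intr_eq0.
have D01 : forall i j, 0 <= D i j <= 1 by move=> i j; rewrite !mxE.
pose w := colsub g c *m \adj D.
have comb : \det D *: c = w *m B'.
  suff e : map_mx intr (\det D *: c) = map_mx intr (w *m B') :> 'rV[rat]_k.
    by apply/rowP => j; apply: (@intr_inj rat); move/rowP/(_ j): e; rewrite !mxE.
  have [u cE] : exists u, map_mx intr c = u *m rowsub f A.
    by apply/submxP; rewrite eq_maxrowsub.
  have colE : map_mx intr (colsub g c) = u *m map_mx intr D.
    apply/rowP => j; have /rowP/(_ (g j)) := cE; rewrite !mxE => ->.
    by apply: eq_bigr => i _; rewrite !mxE.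
  rewrite map_mxZ map_mxM map_mxM colE map_mx_adj -[u *m _ *m _]mulmxA.
  rewrite mul_mx_adj mul_mx_scalar det_map_mx cE scalemxAl; congr (_ *m _).
  by apply/matrixP => i j; rewrite !mxE.
have annih : (\sum_j x j *~ c 0 j) *~ \det D = 0.
  rewrite mulrz_suml.
  transitivity (\sum_j \sum_i x j *~ B' i j *~ w 0 i).
    apply: eq_bigr => j _; rewrite -mulrzA mulrC.
    have -> : \det D * c 0 j = (\det D *: c) 0 j by rewrite mxE.
    by rewrite comb mxE mulrz_sumr; apply: eq_bigr => i _; rewrite -mulrzA mulrC.
  rewrite exchange_big big1 // => i _; rewrite -mulrz_suml.
  by under eq_bigr do rewrite mxE; rewrite Bx mul0rz.
have annih' : (\sum_j x j *~ c 0 j) *+ `|\det D|%N = 0.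
  by move: annih; case: (\det D) => n //= /eqP; rewrite oppr_eq0 => /eqP.
have rk : (\rank A <= k)%N := rank_leq_col A.
have d0 : (0 < `|\det D|)%N by rewrite absz_gt0.
case/orP: (det01_bound D01) => [d1|dr].
  by move: annih'; have -> : `|\det D|%N = 1%N by apply/eqP; rewrite eqn_leq d1.
apply: torsion d0 _ annih'; apply: leq_trans dr _.
exact: leq_fact.
Qed.

(** * The rational model *)

Lemma common_nonroot (I : finType) (F : I -> {poly rat}) :
  (forall i, F i != 0) -> exists a, forall i, (F i).[a] != 0.
Proof.
move=> F0; pose P := \prod_i F i.
have P0 : P != 0 by apply/prodf_neq0.
pose rs := [seq n%:R | n <- iota 0 (size P)] : seq rat.
have urs : uniq rs by rewrite map_inj_uniq ?iota_uniq // => a b /eqP; rewrite eqr_nat => /eqP.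
have /allPn[a _ Pa] : ~~ all (root P) rs.
  by apply/negP => h; have := max_poly_roots P0 h urs; rewrite size_map size_iota ltnn.
exists a => i; apply: contra Pa => /eqP Fi.
by rewrite /root /P horner_prod (bigD1 i) //= Fi mul0r.
Qed.

(** The moment curve (1, a, a^2, ...) meets each hyperplane in finitely many
points, the roots of the polynomial with the coefficients of the equation. *)
Lemma avoid_hyperplanes (I : finType) k (h : I -> 'rV[rat]_k) :
  (forall l, h l != 0) -> exists z : 'cV[rat]_k, forall l, (h l *m z) 0 0 != 0.
Proof.
move=> h0; have [|a ha] := common_nonroot (F := fun l => rVpoly (h l)).
  move=> l; apply: contraNneq (h0 l) => e; rewrite -[h l]rVpolyK e.
  by rewrite linear0.
exists (\col_i a ^+ i) => l; apply: contra_neq (ha l) => <-.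
rewrite /rVpoly horner_poly mxE; apply: eq_bigr => i _.
by rewrite valK mxE.
Qed.

(** The solutions y of the vanishing subset sums are the columns in the image of
[cokermx A], and a functional vanishes on all of them exactly when it is in the
row span of A; such a functional would vanish on x as well. *)
Lemma rational_model (V : zmodType) (k : nat) (x : 'I_k -> V) :
    (forall d v, (0 < d)%N -> (2 * d <= k`!)%N -> v *+ d = 0 -> v = 0 :> V) ->
    (forall i, x i != 0) -> injective x ->
  exists y : 'I_k -> rat, [/\ injective y, forall i, y i != 0 &
    forall A : {set 'I_k}, \sum_(i in A) x i = 0 -> \sum_(i in A) y i = 0].
Proof.
move=> torsion x0 xinj.
pose zs (A : {set 'I_k}) := \sum_(i in A) x i == 0.
(* One row per subset; subsets with nonzero sum get a zero row. *)
pose B := \matrix_(l < #|{set 'I_k}|, j < k)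
   (zs (enum_val l) && (j \in enum_val l))%:R : 'M[int]_(_, _).
pose A : 'M[rat]_(_, _) := map_mx intr B.
have B01 i j : 0 <= B i j <= 1.
  by rewrite mxE; case: (zs _ && _).
have Bx i : \sum_j x j *~ B i j = 0.
  case: (boolP (zs (enum_val i))) => [zi|nzi].
    rewrite -[RHS](eqP zi) [RHS]big_mkcond /=; apply: eq_bigr => j _.
    by rewrite mxE zi /=; case: (_ \in _).
  by rewrite big1 // => j _; rewrite mxE (negPf nzi).
have span c := span01_annihilates (c := c) torsion B01 Bx.
(* The functionals to keep nonzero: y_i, indexed by (i, i), and y_i - y_j. *)
pose e (p : 'I_k * 'I_k) : 'rV[int]_k :=
  if p.1 == p.2 then delta_mx 0 p.1 else delta_mx 0 p.1 - delta_mx 0 p.2.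
have xdelta i : \sum_j x j *~ (delta_mx 0 i : 'rV[int]_k) 0 j = x i.
  rewrite (bigD1 i) //= big1 ?addr0 => [|j ji]; rewrite !mxE ?eqxx //.
  by rewrite (negPf ji).
have e_notin p : map_mx intr (e p) *m cokermx A != 0.
  apply/negP; rewrite -submxE => /span; rewrite /e.
  case: eqVneq => [_|ne].
    by rewrite xdelta => /eqP; rewrite (negPf (x0 _)).
  under eq_bigr do rewrite mxE [in X in _ + X]mxE mulrzBr.
  by rewrite sumrB !xdelta => /subr0_eq /xinj /eqP; rewrite (negPf ne).
have [z hz] := avoid_hyperplanes e_notin.
pose y := cokermx A *m z.
have ydelta i : (map_mx intr (delta_mx 0 i : 'rV[int]_k) *m y) 0 0 = y i 0 :> rat.
  by rewrite map_delta_mx -rowE mxE.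
exists (fun i => y i 0); split=> [i j eij|i|A0 /eqP zA].
- have [//|ne] := eqVneq i j; have := hz (i, j).
  rewrite -mulmxA /e /= (negPf ne) map_mxB mulmxBl mxE [in X in _ + X]mxE.
  by rewrite !ydelta eij subrr eqxx.
- by have := hz (i, i); rewrite -mulmxA /e eqxx ydelta.
- have : (A *m y) (enum_rank A0) 0 = 0 by rewrite mulmxA mulmx_coker mul0mx mxE.
  rewrite mxE => eq0; rewrite -[RHS]eq0 big_mkcond; apply: eq_bigr => j _.
  rewrite !mxE enum_rankK [zs _]zA /=.
  by case: (_ \in _); rewrite ?mul1r ?mul0r.
Qed.

(** * Sequenceability *)

(** The only property of the group that matters is the absence of torsion of
order up to k!/2, which is what the size of the minors requires. *)
Theorem sequenceable_of_torsion_free (V : finZmodType) (S : {set V}) :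
    0 \notin S ->
    (forall d (v : V), (0 < d)%N -> (2 * d <= #|S|`!)%N -> v *+ d = 0 -> v = 0) ->
  sequenceable S.
Proof.
move=> S0 torsion; pose x (i : 'I_#|S|) := enum_val i.
have x0 i : x i != 0 by apply: contraNneq S0 => <-; apply: enum_valP.
have xinj : injective x by apply: enum_val_inj.
have [y [yinj y0 y_sum]] := rational_model torsion x0 xinj.
have [||t pt block] := proper_blocks_nonzero_ordering (y := y) (s := enum 'I_#|S|).
- by rewrite map_inj_uniq ?enum_uniq.
- by apply/allP.
have ut : uniq t by rewrite (perm_uniq pt) enum_uniq.
exists (map x t).
  apply: perm_trans (perm_map x pt) _.
  apply: uniq_perm => [||v]; [by rewrite (map_inj_uniq xinj) enum_uniq|exact: enum_uniq|].
  rewrite mem_enum; apply/mapP/idP => [[i _ ->]|vS]; first exact: enum_valP.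
  by exists (enum_rank_in vS v); rewrite ?mem_enum // /x enum_rankK_in.
move=> i j /andP[ij]; rewrite size_map => jt; rewrite /partial_sum -!map_take !big_map => e.
(* Equal partial sums mean that the block b of terms i + 1, ..., j sums to 0. *)
pose b := drop i (take j t).
have takeE : take j t = take i t ++ b.
  by rewrite -[LHS](cat_take_drop i) take_takel // ltnW.
have b0 : b != [::] by rewrite -size_eq0 size_drop size_takel // subn_eq0 -ltnNge.
have tE : t = take i t ++ b ++ drop j t by rewrite catA -takeE cat_take_drop.
have ub : uniq b by rewrite drop_uniq ?take_uniq.
have sumb (W : zmodType) (F : 'I_#|S| -> W) : \sum_(l in [set l in b]) F l = \sum_(l <- b) F l.
  by rewrite (big_uniq _ ub); apply: eq_bigl => l; rewrite inE.
have xb : \sum_(l in [set l in b]) x l = 0.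
  by rewrite sumb; move: e; rewrite takeE big_cat /= -[LHS]addr0 => /addrI.
have [a0 c0] := block _ _ _ tE b0 (etrans (esym (sumb _ y)) (y_sum _ xb)).
split.
  by move/(congr1 size): a0; rewrite size_takel // (leq_trans (ltnW ij)).
by apply/eqP; rewrite eqn_leq jt -subn_eq0 -size_drop c0.
Qed.

(* The modulus is n.+1; 'I_n.+1 is the additive group of integers mod n.+1,
   for n = 0 as well (unlike 'Z_1, which is Z/2). *)
Theorem theorem3p2 (n k : nat) (hk : (1 <= k)%N)
    (S : {set 'I_n.+1}) (hS0 : (0 : 'I_n.+1) \notin S) (hSk : #|S| = k)
    (hp : forall p : nat, prime p -> (p %| n.+1)%N ->
            (k`!)%:R / 2%:R < p%:R :> rat) :
  sequenceable S.
Proof.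
apply: sequenceable_of_torsion_free hS0 _ => d v d0; rewrite hSk => dk.
have cop : coprime n.+1 d.
  rewrite /coprime; apply/negPn/negP => gcd1; pose p := pdiv (gcdn n.+1 d).
  have pp : prime p by apply: pdiv_prime; rewrite ltn_neqAle eq_sym gcd1 gcdn_gt0.
  have /andP[pn pd] : (p %| n.+1)%N && (p %| d)%N by rewrite -dvdn_gcd pdiv_dvd.
  have := hp p pp pn; rewrite ltr_pdivrMr ?ltr0n // -natrM ltr_nat.
  rewrite ltnNge mulnC (leq_trans _ dk) // leq_pmul2l //.
  exact: dvdn_leq pd.
rewrite Zp_mulrn => /(congr1 val) /= /eqP; rewrite -/(dvdn _ _) Gauss_dvdl // => nv.
apply: val_inj; apply/eqP; rewrite /= -(modn_small (ltn_ord v)).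
exact: nv.
Qed.
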